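(* Let $T$ be a locally finite infinite tree rooted at $\rho$ with branching factor $b$. The hard core model with vertex activity $\lambda>0$ exhibits uniqueness of Gibbs measure on $T$ if at least one of the following holds: (1) $\lambda<\lambda_c(b+1)$; (2) $T$ is spherically symmetric and $\lambda<\lambda_c(b)$, where $\lambda_c(D)=\frac{D^D}{(D-1)^{D+1}}$.
   Context: A cutset of $T$ is a finite set $C$ of vertices such that every infinite path from $\rho$ meets $C$ and no vertex of $C$ is an ancestor of another; $d(\rho,C)=\min_{v\in C}d(\rho,v)$, $|v|=d(\rho,v)$, and $T_{<C}$ is the set of vertices that are neither in $C$ nor descendants of vertices in $C$. Hard core model with activity $\lambda$: independent sets $I$ weighted $\lambda^{|I|}$; for a boundary condition $\sigma$ (fixed occupied/unoccupied states on some vertices, consistent with an independent set), $R_\rho(\sigma,T)=p/(1-p)$ with $p$ the conditional probability that $\rho$ is occupied. The discrepancy $\delta(C)$ of a cutset $C$ is the maximum of $R_\rho(\sigma,T)-R_\rho(\tau,T)$ over boundary conditions $\sigma,\tau$ that fix the states of all vertices of $C$ and of no vertex in $T_{<C}$. Uniqueness of Gibbs measure on $T$ means there is a sequence of cutsets $(B_i)$ with $d(\rho,B_i)\to\infty$ and $\delta(B_i)\to0$. The branching factor is $\mathrm{br}(T)=\inf\{b>0:\inf_C\sum_{v\in C}b^{-|v|}=0\}$, the inner infimum over all cutsets $C$. $T$ is spherically symmetric if the degree of each vertex depends only on its distance from $\rho$. *)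

(* Defs.v *)
From HB Require Import structures.
From mathcomp Require Import all_boot all_order all_algebra.
From mathcomp Require Import finmap.
From mathcomp Require Import all_classical all_reals.
From mathcomp Require Import ereal exp.
Set Implicit Arguments. Unset Strict Implicit. Unset Printing Implicit Defensive.
Import Order.TTheory GRing.Theory Num.Theory.
Local Open Scope classical_set_scope.
Local Open Scope fset_scope.
Local Open Scope ring_scope.

(* A locally finite rooted tree is encoded (Ulam-Harris) by nch : seq nat -> nat,
   the number of children of each vertex; vertices are words v = [i_0;..;i_{n-1}]
   with i_k < nch (take k v); the root rho is [::]; |v| = size v;
   the children of v are rcons v i, i < nch v; ancestors of v are its prefixes. *)
Definition vertex (nch : seq nat -> nat) (v : seq nat) : Prop :=
  forall k, (k < size v)%N -> (nth 0%N v k < nch (take k v))%N.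

Definition infinite_tree (nch : seq nat -> nat) : Prop :=
  forall l : seq (seq nat), exists v, vertex nch v /\ v \notin l.

Definition ray (nch : seq nat -> nat) (r : nat -> nat) : Prop :=
  forall k, (r k < nch (mkseq r k))%N.

Definition is_cutset (nch : seq nat -> nat) (C : {fset (seq nat)}) : Prop :=
  (forall v, v \in C -> vertex nch v) /\
  (forall r, ray nch r -> exists v, v \in C /\ v = mkseq r (size v)) /\
  (forall u v, u \in C -> v \in C -> prefix u v -> u = v).

Definition spherically_symmetric (nch : seq nat -> nat) : Prop :=
  forall u v, vertex nch u -> vertex nch v -> size u = size v -> nch u = nch v.

Definition Tlt (nch : seq nat -> nat) (C : {fset (seq nat)}) : set (seq nat) :=
  [set v | vertex nch v /\ forall u, u \in C -> ~~ prefix u v].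

Definition Uset nch (C : {fset (seq nat)}) : {fset (seq nat)} :=
  fset_set (Tlt nch C) `|` C.

Definition is_child (v w : seq nat) : bool := (size w == (size v).+1) && prefix v w.

Definition indepb (I : {fset (seq nat)}) : bool :=
  all (fun v => all (fun w => ~~ is_child v w) I) I.

(* hard core partition function on T_{<C} u C, boundary condition: the set S
   of occupied vertices of C; occ = whether the root is occupied *)
Definition Zhc (R : realType) nch (lam : R) (C S : {fset (seq nat)}) (occ : bool) : R :=
  \sum_(I <- fpowerset (Uset nch C) |
          [&& indepb I, (I `&` C == S) & (([::] \in I) == occ)])
     lam ^+ #|` I|.

(* R_rho(sigma,T) = p/(1-p) = Z(root occupied)/Z(root unoccupied) *)
Definition Rroot (R : realType) nch (lam : R) (C S : {fset (seq nat)}) : R :=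
  Zhc nch lam C S true / Zhc nch lam C S false.

Definition discrepancy (R : realType) nch (lam : R) (C : {fset (seq nat)}) : R :=
  \big[Num.max/0]_(S <- fpowerset C) \big[Num.max/0]_(S' <- fpowerset C)
     (Rroot nch lam C S - Rroot nch lam C S').

Definition gibbs_unique (R : realType) nch (lam : R) : Prop :=
  exists B : nat -> {fset (seq nat)},
    (forall i, is_cutset nch (B i)) /\
    (forall N, exists i0, forall i, (i0 <= i)%N -> forall v, v \in B i -> (N <= size v)%N) /\
    (forall eps : R, 0 < eps -> exists i0, forall i, (i0 <= i)%N ->
        `|discrepancy nch lam (B i)| < eps).

Local Open Scope ereal_scope.
Definition br (R : realType) (nch : seq nat -> nat) : \bar R :=
  ereal_inf [set b%:E | b in [set b : R | (0 < b)%R /\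
     ereal_inf [set (\sum_(v <- C) b ^- size v)%:E | C in is_cutset nch] = 0]].

(* lambda_c(D) = D^D/(D-1)^(D+1); = +oo for D <= 1 (limit value at D = 1) *)
Definition lambda_c (R : realType) (D : R) : \bar R :=
  if (D <= 1)%R then +oo else ((D `^ D) / ((D - 1) `^ (D + 1)))%:E.

(* Main.v *)
(* Write R_v for the odds of occupation of v in the subtree below v, so that
   R_v = lambda * prod_w 1 / (1 + R_w) over the children w of v.  In the
   coordinate u = arsinh (sqrt R), where R / (1 + R) = tanh^2 u, the mean value
   theorem bounds the change of u_v by
   tanh u_v * sum_w tanh u_w * |change of u_w|.  Choose D > max(1, b) with
   lambda <= lambda_c(D), and put theta = (D - 1) ln (D / (D - 1)) <= 1.  With
   p = tanh^2 u = 1 - exp (- t), the function p^(1/theta) / t is maximal at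
   p = 1 / D, so sum_w p_w^(1/theta) is at most a constant times
   T = sum_w t_w, while p_v depends on T only through
   R_v = lambda * exp (- T).  Optimising over T and applying Hoelder's
   inequality with exponents 2 / theta and q gives
   |change of u_v|^q <= D^-1 * sum_w |change of u_w|^q.
   Iterating down to a cutset C, the discrepancy of C is at most a constant
   times (sum_(v in C) D^(-|v|))^(1/q), and since D > b this sum can be made
   arbitrarily small; a small sum also forces C to be far from the root. *)
Require Import Defs.
From HB Require Import structures.
From mathcomp Require Import all_boot all_order all_algebra.
From mathcomp Require Import finmap.
From mathcomp Require Import all_classical all_reals.
From mathcomp Require Import ereal sequences topology normedtype derive realfun exp.
From mathcomp Require Import ring lra.
Set Implicit Arguments. Unset Strict Implicit. Unset Printing Implicit Defensive.
Import Order.TTheory GRing.Theory Num.Theory.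
Import numFieldNormedType.Exports.
Local Open Scope ring_scope.

(** * Extremal occupation probabilities *)

Section Analysis.
Context {R : realType}.
Implicit Types (x y t u D lam : R).

(** Divide by exp(wy) and apply 1 + x <= exp x to exp(-wy) and exp((1-w)y): with weights 1 - w and w
    the linear terms cancel and leave 1. *)
Lemma expR_weighted_le (w y : R) : 0 <= w <= 1 ->
  expR (w * y) <= 1 - w + w * expR y.
Proof.
move=> /andP[w0 w1].
have h1 := expR_ge1Dx (- (w * y)).
have h2 := expR_ge1Dx ((1 - w) * y).
have e2 : expR ((1 - w) * y) = expR (- (w * y)) * expR y.
  by rewrite -expRD; congr expR; ring.
rewrite -[leLHS]mulr1 -ler_pdivlMl ?expR_gt0 // -expRN mulrDr [_ * (w * _)]mulrCA -e2.
have : (1 - w) * (1 - w * y) <= (1 - w) * expR (- (w * y)).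
  by rewrite ler_wpM2l // subr_ge0.
have : w * (1 + (1 - w) * y) <= w * expR ((1 - w) * y) by rewrite ler_wpM2l.
by move=> *; nra.
Qed.

(** Convexity of exp with weight a / b: the slope of the chord starting at 0 increases. *)
Lemma expRB1_div_incr (a b : R) : 0 < a -> a <= b ->
  b * (expR a - 1) <= a * (expR b - 1).
Proof.
move=> a0 ab; have b0 : 0 < b by exact: lt_le_trans ab.
have w01 : 0 <= a / b <= 1.
  by rewrite (divr_ge0 (ltW a0) (ltW b0)) ler_pdivrMr // mul1r.
have := expR_weighted_le b w01; rewrite divfK ?gt_eqF // => h.
have -> : a * (expR b - 1) = b * ((a / b) * (expR b - 1)).
  by rewrite mulrA (mulrC b) divfK ?gt_eqF.
by rewrite ler_wpM2l ?(ltW b0) //; lra.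
Qed.

Lemma derive_sign_ge_min (f df : R -> R) (a t : R) : 0 < a -> 0 < t ->
  (forall x, 0 < x -> is_derive x 1 f (df x)) ->
  (forall x, 0 < x -> x <= a -> df x <= 0) -> (forall x, a <= x -> 0 <= df x) ->
  f a <= f t.
Proof.
move=> a0 t0 fd neg pos.
have cts (x y : R) : 0 < x -> {within `[x, y], continuous f}%classic.
  move=> x0; apply: derivable_within_continuous => z.
  rewrite in_itv /= => /andP[xz _].
  by have [] := fd z (lt_le_trans x0 xz).
have fd' (y z x : R) : 0 < y -> x \in `]y, z[ -> is_derive x 1 f (df x).
  by move=> y0; rewrite in_itv /= => /andP[yx _]; apply/fd/(lt_trans y0).
have [at_|ta|->//] := ltgtP a t.
  have [c] := MVT at_ (fun x => @fd' a t x a0) (cts _ _ a0).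
  rewrite in_itv /= => /andP[ac _] E.
  by rewrite -subr_ge0 E mulr_ge0 ?subr_ge0 ?(ltW at_) // pos // ltW.
have [c] := MVT ta (fun x => @fd' t a x t0) (cts _ _ t0).
rewrite in_itv /= => /andP[tc ca] E.
rewrite -subr_le0 E mulr_le0_ge0 ?subr_ge0 ?(ltW ta) // neg //.
  exact: lt_trans tc.
exact: ltW.
Qed.

Lemma onem_expRN_gt0 t : 0 < t -> 0 < 1 - expR (- t).
Proof. by move=> t0; rewrite subr_gt0 expR_lt1 oppr_lt0. Qed.

(** As a function of ln t, ln(1 - exp(-t)) has slope t / (exp t - 1). This decreases, so the graph
    lies below its tangent at ln a: the gap [f] between the two is minimal at a. *)
Lemma ln_onem_expRN_le (a t : R) : 0 < a -> 0 < t ->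
  ln (1 - expR (- t)) - ln (1 - expR (- a)) <= a / (expR a - 1) * (ln t - ln a).
Proof.
move=> a0 t0; set th := a / _.
pose f x := th * ln x - ln (1 - expR (- x)).
pose df x := th * x^-1 - (1 - expR (- x))^-1 * expR (- x).
suff : f a <= f t by rewrite /f; lra.
have e1 x : 0 < x -> 0 < expR x - 1 by move=> x0; rewrite subr_gt0 expR_gt1.
have dfE x : 0 < x -> df x = (a * (expR x - 1) - x * (expR a - 1))
    / (x * ((expR x - 1) * (expR a - 1))).
  move=> x0; rewrite /df /th expRN.
  have := e1 x x0; have := e1 a a0; have := expR_gt0 x; move=> *.
  field; rewrite !gt_eqF //=.
apply: (@derive_sign_ge_min f df) => //.
- move=> x x0; rewrite /f.
  have lnx := is_derive1_ln x0.
  have lny := is_derive1_ln (onem_expRN_gt0 x0).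
  have h1 : is_derive x 1 (fun x => th * ln x) (th * x^-1).
    exact: (@is_deriveZ _ _ _ (@ln R) th x 1 _ lnx).
  have hN : is_derive x 1 (fun x : R => - x) (- 1) by exact: is_deriveNid.
  have h2 : is_derive x 1 (fun x => expR (- x)) (expR (- x) * (-1)).
    exact: (@is_derive1_comp _ (@expR R) (fun x => - x)).
  have h3 : is_derive x 1 (fun x => 1 - expR (- x)) (0 - expR (- x) * (-1)).
    exact: (is_deriveB (is_derive_cst (1 : R) x 1) h2).
  have h4 := is_deriveB h1
    (@is_derive1_comp _ (@ln R) (fun x => 1 - expR (- x)) x _ _ lny h3).
  apply: is_derive_eq h4 _; rewrite /df; ring.
- move=> x x0 xa; rewrite dfE // pmulr_lle0; last first.
    by rewrite invr_gt0 !mulr_gt0 ?e1.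
  by rewrite subr_le0 expRB1_div_incr.
- move=> x ax; have x0 : 0 < x by exact: lt_le_trans ax.
  rewrite dfE // pmulr_lge0; last by rewrite invr_gt0 !mulr_gt0 ?e1.
  by rewrite subr_ge0 expRB1_div_incr.
Qed.


(** With p = 1 - exp(-t) and theta = a / (exp a - 1), this makes p^(1/theta) / t maximal at t =
    a. *)
Lemma onem_expRN_le (a t : R) : 0 < a -> 0 <= t ->
  1 - expR (- t) <= (1 - expR (- a)) * (t / a) `^ (a / (expR a - 1)).
Proof.
move=> a0; rewrite le_eqVlt => /predU1P[<-|t0].
  by rewrite oppr0 expR0 subrr mulr_ge0 ?powR_ge0 // ltW // onem_expRN_gt0.
have ta0 : 0 < t / a by rewrite divr_gt0.
have pa := onem_expRN_gt0 a0; have pt := onem_expRN_gt0 t0.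
rewrite -ler_ln ?posrE ?mulr_gt0 ?powR_gt0 // lnM ?posrE ?powR_gt0 //.
rewrite ln_powR ln_div ?posrE // -lerBlDl.
exact: ln_onem_expRN_le.
Qed.

(* [p_i = 1 - exp(- t_i)] is the occupation probability of child [i] and [x0]
   the odds of the parent; equality holds when there are [D] children (for
   integral [D]) with all [p_i = 1 / D]. *)
Lemma occupation_bound (D lam : R) (n : nat) (t : 'I_n -> R) (x0 : R)
    (th := (D - 1) * ln (D / (D - 1))) :
  1 < D -> lam <= D `^ D / (D - 1) `^ (D + 1) ->
  (forall i, 0 <= t i) -> 0 <= x0 -> x0 <= lam * expR (- \sum_i t i) ->
  x0 / (1 + x0) * (\sum_i (1 - expR (- t i)) `^ th^-1) `^ th <= D `^ (th - 2).
Proof.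
move=> D1 lamD t0 x00 x0le.
have D0 : 0 < D by exact: lt_trans D1.
have Dm0 : 0 < D - 1 by rewrite subr_gt0.
(* The tangent point [a] is the value of t at which 1 - exp(-t) = 1 / D; there the exponent a / (exp
   a - 1) is exactly [th]. *)
set a := ln (D / (D - 1)) in th *.
have ea : expR a = D / (D - 1) by rewrite lnK // posrE divr_gt0.
have eaB : expR a - 1 = (D - 1)^-1 by rewrite ea; field; rewrite gt_eqF.
have a0 : 0 < a by rewrite -expR_gt1 -subr_gt0 eaB invr_gt0.
have pa : 1 - expR (- a) = D^-1.
  by rewrite expRN ea; field; rewrite !gt_eqF.
have th0 : 0 < th by rewrite mulr_gt0.
have thE : a / (expR a - 1) = th by rewrite eaB invrK mulrC.
set T := \sum_i t i.
have T0 : 0 <= T by exact: sumr_ge0.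
(* The bound for each summand is linear in [t i], so only the total T remains. *)
have sumle : \sum_i (1 - expR (- t i)) `^ th^-1 <= D `^ (- th^-1) * (T / a).
  rewrite /T mulr_suml mulr_sumr; apply: ler_sum => i _.
  have pi0 : 0 <= 1 - expR (- t i) by rewrite subr_ge0 expR_le1 oppr_le0.
  have -> : D `^ (- th^-1) * (t i / a)
      = ((1 - expR (- a)) * (t i / a) `^ (a / (expR a - 1))) `^ th^-1.
    rewrite pa thE (@powRM _ D^-1) ?powR_ge0 ?invr_ge0 ?(ltW D0) //.
    rewrite -powRrM divff ?gt_eqF // powRr1 ?divr_ge0 ?(ltW a0) //.
    by rewrite -(@powR_inv1 _ D) ?(ltW D0) // -powRrM mulN1r.
  apply: ge0_ler_powR; rewrite ?nnegrE ?invr_ge0 ?(ltW th0) //.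
    by rewrite pa mulr_ge0 ?powR_ge0 // invr_ge0 ltW.
  exact: onem_expRN_le.
have sumle' : (\sum_i (1 - expR (- t i)) `^ th^-1) `^ th <= D^-1 * (T / a) `^ th.
  have -> : D^-1 * (T / a) `^ th = (D `^ (- th^-1) * (T / a)) `^ th.
    rewrite (@powRM _ (D `^ _)) ?powR_ge0 ?divr_ge0 ?(ltW a0) //
      -powRrM mulNr mulVf ?gt_eqF //.
    by rewrite powR_inv1 ?(ltW D0).
  apply: ge0_ler_powR; rewrite ?nnegrE ?(ltW th0) //.
    by apply: sumr_ge0 => i _; exact: powR_ge0.
  by rewrite mulr_ge0 ?powR_ge0 ?divr_ge0 ?(ltW a0).
have p00 : 0 <= x0 / (1 + x0) by rewrite divr_ge0 // addr_ge0.
apply: le_trans (ler_wpM2l p00 sumle') _.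
have [T_0|Tn0] := eqVneq T 0.
  rewrite T_0 mul0r powR0 ?gt_eqF // !mulr0; exact: powR_ge0.
have {Tn0}T0 : 0 < T by rewrite lt0r Tn0.
(* [Ts] is the value of T at the extremal configuration, and [y] the deviation from it; the weight
   [w] is 1 - 1 / D. *)
set Ts := D * a; have Ts0 : 0 < Ts by rewrite mulr_gt0.
set w := (D - 1) / D; set y := T - Ts.
have w01 : 0 <= w <= 1.
  by rewrite /w (divr_ge0 (ltW Dm0) (ltW D0)) ler_pdivrMr // mul1r gerBl ler01.
have lcE : D `^ D / (D - 1) `^ (D + 1) = expR Ts / (D - 1).
  rewrite /powR !gt_eqF // -expRB /Ts /a ln_div ?posrE //.
  rewrite -{3}(lnK (x := D - 1)) ?posrE // -expRB; congr expR; ring.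
(* The map x / (1 + x) is increasing, and by [lcE] the odds [x0] are at most exp(-y) / (D - 1). *)
have p0le : x0 / (1 + x0) <= (D * (1 - w + w * expR y))^-1.
  set z := expR (- y) / (D - 1).
  have z0 : 0 < z by rewrite divr_gt0 ?expR_gt0.
  have xz : x0 <= z.
    apply: le_trans x0le _; rewrite -/T /z.
    apply: le_trans (ler_wpM2r (expR_ge0 _) lamD) _.
    by rewrite lcE /y opprB expRD mulrAC.
  have -> : (D * (1 - w + w * expR y))^-1 = z / (1 + z).
    rewrite /z /w expRN; have := expR_gt0 y; move: (expR y) => e e0.
    have h : 0 < 1 + e * (D - 1) by rewrite addr_gt0 // mulr_gt0.
    field; rewrite !gt_eqF //=; nra.
  rewrite ler_pdivrMr ?ltr_pwDl // mulrAC ler_pdivlMr ?addr_gt0 //.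
  by rewrite !mulrDr !mulr1 (mulrC z) lerD2r.
(* This is ln x <= x - 1 at x = T / Ts, together with th / Ts = w. *)
have rle : (T / a) `^ th <= D `^ th * expR (w * y).
  have -> : T / a = D * (T / Ts) by rewrite /Ts; field; rewrite !gt_eqF.
  have r0 : 0 < T / Ts by rewrite divr_gt0.
  rewrite powRM ?(ltW D0) ?(ltW r0) // ler_wpM2l ?powR_ge0 //.
  rewrite /powR gt_eqF // ler_expR.
  have -> : w * y = th * (T / Ts - 1).
    by rewrite /w /y /th /Ts; field; rewrite !gt_eqF.
  rewrite ler_pM2l //; have := @le_ln1Dx R (T / Ts - 1).
  by rewrite [1 + _]addrC subrK; apply; rewrite ltrBrDl subrr.
have W0 : 0 < 1 - w + w * expR y.
  exact: lt_le_trans (expR_gt0 _) (expR_weighted_le y w01).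
(* In the product of the two bounds, convexity of exp lets exp(wy) cancel against 1 - w + w exp
   y. *)
have := ler_pM p00 (powR_ge0 _ _) p0le rle => h.
rewrite mulrCA ler_pdivrMl //.
apply: le_trans h _.
have -> : D * D `^ (th - 2) = D `^ th / D.
  have D2 : D `^ 2 = D ^+ 2 := powR_mulrn 2 (ltW D0).
  rewrite powRB ?(gt_eqF D0) ?implybT // D2.
  by field; rewrite gt_eqF.
rewrite invfM mulrACA [D^-1 * _]mulrC ler_piMr ?divr_ge0 ?powR_ge0 ?(ltW D0) //.
by rewrite mulrC ler_pdivrMr // mul1r expR_weighted_le.
Qed.

End Analysis.

(** * Contraction of the tree recursion *)

Section Contraction.
Context {R : realType}.
Implicit Types (x y t u D lam : R).

Lemma sum_powR_eq0 (n : nat) (a : 'I_n -> R) (p : R) i :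
  (forall i, 0 <= a i) -> \sum_i a i `^ p = 0 -> a i = 0.
Proof.
move=> a0 /eqP; rewrite psumr_eq0; last by move=> *; exact: powR_ge0.
by move=> /allP/(_ i); rewrite mem_index_enum => /(_ isT)/eqP/powR_eq0_eq0.
Qed.

(** Both families are scaled to norm 1 and Young's inequality is summed over i; a vanishing norm
    makes every term vanish. *)
Lemma hoelder_sum (n : nat) (a b : 'I_n -> R) (p q : R) :
  0 < p -> 0 < q -> p^-1 + q^-1 = 1 ->
  (forall i, 0 <= a i) -> (forall i, 0 <= b i) ->
  \sum_i a i * b i <=
    (\sum_i a i `^ p) `^ p^-1 * (\sum_i b i `^ q) `^ q^-1.
Proof.
move=> p0 q0 pq a0 b0.
set A := _ `^ p^-1; set B := _ `^ q^-1.
have [A_0|An0] := eqVneq A 0.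
  rewrite A_0 mul0r big1 // => i _.
  by rewrite (sum_powR_eq0 i a0 (powR_eq0_eq0 A_0)) mul0r.
have [B_0|Bn0] := eqVneq B 0.
  rewrite B_0 mulr0 big1 // => i _.
  by rewrite (sum_powR_eq0 i b0 (powR_eq0_eq0 B_0)) mulr0.
have {An0}A0 : 0 < A by rewrite lt0r An0 powR_ge0.
have {Bn0}B0 : 0 < B by rewrite lt0r Bn0 powR_ge0.
have norm (c : 'I_n -> R) (r C : R) : 0 < r -> (forall i, 0 <= c i) ->
    C = (\sum_i c i `^ r) `^ r^-1 -> 0 < C -> \sum_i (c i / C) `^ r = 1.
  move=> r0 c0 CE C0.
  under eq_bigr do rewrite powRM ?invr_ge0 ?(ltW C0) //.
  have -> : C^-1 `^ r = (C `^ r)^-1.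
    by rewrite -powR_inv1 ?(ltW C0) // -powRrM mulN1r powRN.
  rewrite -mulr_suml CE -powRrM mulVf ?gt_eqF // powRr1 ?divff //.
    by apply: contraTneq C0 => S0; rewrite CE S0 powR0 ?ltxx // invr_eq0 gt_eqF.
  by apply: sumr_ge0 => *; exact: powR_ge0.
have nA := norm a p A p0 a0 erefl A0; have nB := norm b q B q0 b0 erefl B0.
clearbody A B; rewrite -ler_pdivrMr // -[leRHS]mul1r -ler_pdivrMr // -pq.
rewrite -[p^-1]mul1r -[q^-1]mul1r -{1}nA -nB !mulr_suml -big_split /=.
apply: ler_sum => i _.
have -> : a i * b i / B / A = (a i / A) * (b i / B) by ring.
by apply: conjugate_powR => //; rewrite divr_ge0 // ltW.
Qed.

(** * The hyperbolic coordinate of the odds *)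

Definition ch (u : R) := (expR u + expR (- u)) / 2.
Definition sh (u : R) := (expR u - expR (- u)) / 2.
Definition asinh_sqrt (x : R) := ln (Num.sqrt x + Num.sqrt (1 + x)).

Lemma is_derive_expRN (u : R) :
  is_derive u 1 (fun u => expR (- u)) (- expR (- u)).
Proof.
have hN : is_derive u 1 (fun x : R => - x) (- 1) by exact: is_deriveNid.
have h2 : is_derive u 1 (fun x => expR (- x)) (expR (- u) * (-1)).
  exact: (@is_derive1_comp _ (@expR R) (fun x => - x)).
by apply: is_derive_eq h2 _; rewrite mulrN1.
Qed.

Lemma is_derive_ch u : is_derive u 1 ch (sh u).
Proof.
have := is_deriveZ 2^-1 (is_deriveD (is_derive_expR u) (is_derive_expRN u)).
have -> : 2^-1 \*: (@expR R + (fun u => expR (- u))) = ch.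
  by apply/funext => x; rewrite /ch /= mulrC.
by move=> h; apply: is_derive_eq h _; rewrite /sh mulrC.
Qed.

Lemma ch_gt0 u : 0 < ch u.
Proof. by rewrite divr_gt0 ?addr_gt0 ?expR_gt0. Qed.

Lemma chsh u : ch u ^+ 2 - sh u ^+ 2 = 1.
Proof.
rewrite /ch /sh expRN; field.
by rewrite gt_eqF ?expR_gt0.
Qed.

Lemma sqrt_add_sqrt_gt0 x : 0 <= x -> 0 < Num.sqrt x + Num.sqrt (1 + x).
Proof. by move=> x0; rewrite ltr_wpDl ?sqrtr_ge0 // sqrtr_gt0 ltr_pwDl. Qed.

(** This turns the factors 1 + R_w of the recursion into smooth functions of the coordinates, even
    at R_w = 0. *)
Lemma ch_asinh_sqrt x : 0 <= x -> ch (asinh_sqrt x) ^+ 2 = 1 + x.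
Proof.
move=> x0; have S0 := sqrt_add_sqrt_gt0 x0.
rewrite /ch /asinh_sqrt expRN lnK ?posrE //.
have -> : (Num.sqrt x + Num.sqrt (1 + x))^-1 = Num.sqrt (1 + x) - Num.sqrt x.
  apply: (mulfI (lt0r_neq0 S0)); rewrite divff ?gt_eqF // mulrC
    [_ + Num.sqrt (1 + _)]addrC.
  by rewrite -subr_sqr !sqr_sqrtr ?addr_ge0 // addrK.
have -> : Num.sqrt x + Num.sqrt (1 + x) + (Num.sqrt (1 + x) - Num.sqrt x)
    = Num.sqrt (1 + x) * 2 by ring.
by rewrite mulfK ?pnatr_eq0 // sqr_sqrtr ?addr_ge0.
Qed.

(** The variable is the logarithm of the odds, so the square root is only differentiated at positive
    points. The derivative is tanh(u) / 2 at u = arsinh (sqrt (exp L)). *)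
Lemma is_derive_asinh_sqrt_expR (L : R) :
  is_derive L 1 (asinh_sqrt \o expR)
    (Num.sqrt (expR L / (1 + expR L)) / 2).
Proof.
have e0 := expR_gt0 L; have e1 : 0 < 1 + expR L by rewrite addr_gt0.
have h1 : is_derive L 1 (Num.sqrt \o expR) ((2 * Num.sqrt (expR L))^-1 * expR L).
  exact: (is_derive1_comp (is_derive1_sqrt e0) (is_derive_expR L)).
have h2 : is_derive L 1 (fun x => 1 + expR x) (0 + expR L).
  exact: (is_deriveD (is_derive_cst (1 : R) L 1) (is_derive_expR L)).
have h3 := @is_derive1_comp _ _ (fun x => 1 + expR x) L _ _ (is_derive1_sqrt e1) h2.
have s0 : 0 < Num.sqrt (expR L) by rewrite sqrtr_gt0.
have c0 : 0 < Num.sqrt (1 + expR L) by rewrite sqrtr_gt0.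
have h4 := @is_derive1_comp _ (@ln R) _ L _ _
  (is_derive1_ln (sqrt_add_sqrt_gt0 (ltW e0))) (is_deriveD h1 h3).
apply: (is_derive_eq h4); rewrite add0r sqrtrM ?(ltW e0) // sqrtrV ?(ltW e1) //.
have eE : expR L = Num.sqrt (expR L) ^+ 2 by rewrite sqr_sqrtr // ltW.
set s := Num.sqrt (expR L) in s0 eE *; set c := Num.sqrt (1 + expR L) in c0 *.
clearbody s c; rewrite eE.
by field; rewrite !gt_eqF // addr_gt0.
Qed.

Lemma is_derive_ln_ch2 u :
  is_derive u 1 (fun u => ln (ch u ^+ 2)) (2 * (sh u / ch u)).
Proof.
have -> : (fun u => ln (ch u ^+ 2)) = 2 \*: (@ln R \o ch).
  by apply/funext => x /=; rewrite lnXn ?ch_gt0 // -[RHS]/(2 * ln (ch x)) mulr_natl.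
apply: is_derive_eq (is_deriveZ 2
  (is_derive1_comp (is_derive1_ln (ch_gt0 u)) (is_derive_ch u))) _.
by rewrite /GRing.scale /= [_^-1 * _]mulrC.
Qed.

(** It matches p = tanh^2 u with t = ln (ch^2 u), the form in which [occupation_bound] is
    applied. *)
Lemma sqr_tanh u : (sh u / ch u) ^+ 2 = 1 - expR (- ln (ch u ^+ 2)).
Proof.
rewrite expRN lnK ?posrE ?exprn_gt0 ?ch_gt0 // expr_div_n.
have := chsh u; have := ch_gt0 u; move: (ch u) (sh u) => c s c0 E.
have -> : s ^+ 2 = c ^+ 2 - 1 by rewrite -E; ring.
by field; rewrite gt_eqF.
Qed.

Lemma ler_asinh_sqrt x y : 0 <= x -> x <= y -> asinh_sqrt x <= asinh_sqrt y.
Proof.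
move=> x0 xy; have y0 := le_trans x0 xy.
by rewrite ler_ln ?posrE ?sqrt_add_sqrt_gt0 // lerD // ler_wsqrtr // lerD2l.
Qed.

Lemma asinh_sqrt_ge0 x : 0 <= x -> 0 <= asinh_sqrt x.
Proof.
move=> x0; apply: le_trans (ler_asinh_sqrt (lexx 0) x0).
by rewrite /asinh_sqrt sqrtr0 addr0 sqrtr1 add0r ln1.
Qed.

(** Converts closeness of coordinates back into closeness of odds. For x <= y, factor y - x as a
    difference of squares of square roots: the sum of the roots is at most 2 exp(u_y), and their
    difference at most exp(u_y) - exp(u_x) <= exp(u_y) (u_y - u_x). *)
Lemma dist_le_asinh_sqrt x y M : 0 <= x <= M -> 0 <= y <= M ->
  `|x - y| <= 2 * expR (asinh_sqrt M) ^+ 2 * `|asinh_sqrt x - asinh_sqrt y|.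
Proof.
wlog xy : x y / x <= y => [H|].
  move=> xM yM; have [/H|/ltW/H] := leP x y; first exact.
  by rewrite distrC [X in _ * X]distrC; apply.
move=> /andP[x0 xM] /andP[y0 yM].
rewrite distrC ger0_norm ?subr_ge0 // distrC ger0_norm ?subr_ge0 ?ler_asinh_sqrt //.
have M0 := le_trans x0 xM.
have EM := ler_asinh_sqrt y0 yM.
have := @expR_ge1Dx R (asinh_sqrt x - asinh_sqrt y).
have Ey0 := expR_gt0 (asinh_sqrt y).
rewrite expRB ler_pdivlMr // => h.
have xyE : y - x = (Num.sqrt y - Num.sqrt x) * (Num.sqrt y + Num.sqrt x).
  by rewrite -subr_sqr !sqr_sqrtr.
have Ele : Num.sqrt y - Num.sqrt x <= expR (asinh_sqrt y) - expR (asinh_sqrt x).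
  rewrite !lnK ?posrE ?sqrt_add_sqrt_gt0 //.
  have : Num.sqrt (1 + x) <= Num.sqrt (1 + y) by rewrite ler_wsqrtr // lerD2l.
  by lra.
have s2 : Num.sqrt y + Num.sqrt x <= 2 * expR (asinh_sqrt y).
  rewrite lnK ?posrE ?sqrt_add_sqrt_gt0 //.
  have : Num.sqrt x <= Num.sqrt y by rewrite ler_wsqrtr.
  by have := sqrtr_ge0 (1 + y); lra.
set d := asinh_sqrt y - asinh_sqrt x.
have d0 : 0 <= d by rewrite subr_ge0 ler_asinh_sqrt.
have h' : Num.sqrt y - Num.sqrt x <= expR (asinh_sqrt y) * d by rewrite /d; nra.
have sxy : 0 <= Num.sqrt y - Num.sqrt x by rewrite subr_ge0 ler_wsqrtr.
rewrite xyE; apply: le_trans (ler_pM sxy _ h' s2) _.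
  by rewrite addr_ge0 ?sqrtr_ge0.
have -> : expR (asinh_sqrt y) * d * (2 * expR (asinh_sqrt y))
    = 2 * expR (asinh_sqrt y) ^+ 2 * d by ring.
apply: (ler_wpM2r d0); apply: ler_wpM2l; first exact: ler0n.
by rewrite lerXn2r ?nnegrE ?expR_ge0 ?ler_expR.
Qed.

(** * One step of the recursion *)

Section Recursion.
Context (D lam : R).
Let th := (D - 1) * ln (D / (D - 1)).
Let q := (1 - th / 2)^-1.
Hypotheses (D1 : 1 < D) (lam0 : 0 < lam).
Hypothesis lamD : lam <= D `^ D / (D - 1) `^ (D + 1).

Lemma theta_gt0 : 0 < th.
Proof.
rewrite mulr_gt0 ?subr_gt0 // ln_gt0 // ltr_pdivlMr ?subr_gt0 // mul1r.
by rewrite gtrBl.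
Qed.

(** From ln(1 + z) <= z at z = 1 / (D - 1). It keeps 1 - th / 2 positive, hence also [q]. *)
Lemma theta_le1 : th <= 1.
Proof.
have Dm0 : 0 < D - 1 by rewrite subr_gt0.
rewrite /th; have -> : D / (D - 1) = 1 + (D - 1)^-1 by field; rewrite gt_eqF.
rewrite -ler_pdivlMl // mulr1 le_ln1Dx //.
by apply: lt_trans (_ : 0 < _); rewrite ?invr_gt0 // ltrN10.
Qed.

Lemma expo_gt0 : 0 < q.
Proof. by rewrite invr_gt0; have := theta_le1; lra. Qed.

(** The left side is the speed of the parent's coordinate when the children's coordinates move with
    speeds [d i]. Hoelder with exponents 2 / th and [q] separates the speeds; what remains is the
    square root of the left side of [occupation_bound], at most D^((th - 2) / 2) = D^(-1/q). *)
Lemma weighted_sum_le (n : nat) (u d : 'I_n -> R)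
    (L := ln lam - \sum_i ln (ch (u i) ^+ 2)) :
  `|Num.sqrt (expR L / (1 + expR L)) / 2 *
     (\sum_i 2 * (sh (u i) / ch (u i)) * d i)| <=
  (D^-1 * \sum_i `|d i| `^ q) `^ q^-1.
Proof.
have th0 := theta_gt0; have q0 := expo_gt0.
have D0 : 0 < D by exact: lt_trans D1.
pose r i := `|sh (u i) / ch (u i)|.
have -> : \sum_i 2 * (sh (u i) / ch (u i)) * d i
    = 2 * \sum_i (sh (u i) / ch (u i)) * d i.
  by rewrite mulr_sumr; apply: eq_bigr => i _; rewrite -[LHS]mulrA.
rewrite mulrA divfK ?pnatr_eq0 // normrM ger0_norm ?sqrtr_ge0 //.
have hsum : `|\sum_i sh (u i) / ch (u i) * d i| <= \sum_i r i * `|d i|.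
  by apply: le_trans (ler_norm_sum _ _ _) _; apply: ler_sum => i _; rewrite normrM.
have hh : \sum_i r i * `|d i| <= (\sum_i r i `^ (2 / th)) `^ (2 / th)^-1 *
      (\sum_i `|d i| `^ q) `^ q^-1.
  have pq : (2 / th)^-1 + q^-1 = 1 by rewrite invf_div invrK addrC subrK.
  exact: (hoelder_sum (divr_gt0 (ltr0Sn _ 1) th0) q0 pq
            (fun i => normr_ge0 _) (fun i => normr_ge0 _)).
apply: le_trans (ler_wpM2l (sqrtr_ge0 _) (le_trans hsum hh)) _.
have S0 : 0 <= \sum_i `|d i| `^ q by apply: sumr_ge0 => *; exact: powR_ge0.
have Dq : D^-1 `^ q^-1 = D `^ (- q^-1).
  by rewrite -powR_inv1 ?(ltW D0) // -powRrM mulN1r.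
rewrite (@powRM _ D^-1) ?invr_ge0 ?(ltW D0) // Dq.
rewrite mulrA ler_wpM2r ?powR_ge0 //.
have t0 i : 0 <= ln (ch (u i) ^+ 2).
  by rewrite ln_ge0 // -[ch _ ^+ 2](subrK (sh (u i) ^+ 2)) chsh lerDl sqr_ge0.
have LE : expR L <= lam * expR (- \sum_i ln (ch (u i) ^+ 2)).
  by rewrite expRD lnK // posrE.
have := occupation_bound D1 lamD t0 (expR_ge0 L) LE; rewrite -/th.
have -> : \sum_i (1 - expR (- ln (ch (u i) ^+ 2))) `^ th^-1
    = \sum_i r i `^ (2 / th).
  apply: eq_bigr => i _; rewrite -sqr_tanh powRrM -/(r i).
  by rewrite -[_ ^+ 2]ger0_norm ?sqr_ge0 // normrX -(powR_mulrn 2).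
move=> h.
have p0 : 0 <= expR L / (1 + expR L) by rewrite divr_ge0 ?addr_ge0 ?expR_ge0.
have -> : (\sum_i r i `^ (2 / th)) `^ (2 / th)^-1
     = Num.sqrt ((\sum_i r i `^ (2 / th)) `^ th).
  by rewrite -powR12_sqrt ?powR_ge0 // -powRrM invf_div.
have -> : D `^ (- q^-1) = Num.sqrt (D `^ (th - 2)).
  rewrite -powR12_sqrt ?powR_ge0 // -powRrM /q invrK; congr (_ `^ _).
  by field.
by rewrite -sqrtrM // ler_wsqrtr.
Qed.

Lemma asinh_sqrt_contraction (n : nat) (x y : 'I_n -> R) :
  (forall i, 0 <= x i) -> (forall i, 0 <= y i) ->
  `|asinh_sqrt (lam * \prod_i (1 + x i)^-1)
      - asinh_sqrt (lam * \prod_i (1 + y i)^-1)| `^ q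
    <= D^-1 * \sum_i `|asinh_sqrt (x i) - asinh_sqrt (y i)| `^ q.
Proof.
move=> x0 y0; have q0 := expo_gt0.
pose d i := asinh_sqrt (x i) - asinh_sqrt (y i).
(* The mean value theorem is applied along the segment from y (s = 0) to x (s = 1), straight in the
   hyperbolic coordinates; [L s] is the logarithm of the parent's odds. *)
pose u (s : R) i := asinh_sqrt (y i) + s * d i.
pose L s := ln lam - \sum_i ln (ch (u s i) ^+ 2).
pose g := (asinh_sqrt \o expR) \o L.
pose dg s := Num.sqrt (expR (L s) / (1 + expR (L s))) / 2 *
     - (\sum_i 2 * (sh (u s i) / ch (u s i)) * d i).
have du (s : R) i : is_derive s 1 (fun s => u s i) (d i).
  have h := is_deriveD (is_derive_cst (asinh_sqrt (y i)) s 1)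
              (is_deriveZ (d i) (is_derive_id s 1)).
  have -> : (fun s => u s i) = cst (asinh_sqrt (y i)) + d i \*: id.
    by apply/funext => z; rewrite /u /= [z * _]mulrC.
  by apply: is_derive_eq h _; rewrite add0r /GRing.scale /= mulr1.
have dL (s : R) : is_derive s 1 L (0 - \sum_i 2 * (sh (u s i) / ch (u s i)) * d i).
  have h i : is_derive s 1 ((fun u => ln (ch u ^+ 2)) \o (fun s => u s i))
       (2 * (sh (u s i) / ch (u s i)) * d i).
    exact: is_derive1_comp (is_derive_ln_ch2 _) (du s i).
  have -> : L = cst (ln lam) - \sum_i ((fun u => ln (ch u ^+ 2)) \o (fun s => u s i)).
    by apply/funext => z; rewrite /L /= !fctE fct_sumE.
  exact: is_deriveB (is_derive_cst _ _ _) (is_derive_sum h).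
have gd (s : R) : is_derive s 1 g (dg s).
  rewrite /g /dg -[- (\sum_i _)]sub0r.
  exact: is_derive1_comp (is_derive_asinh_sqrt_expR _) (dL s).
have [|c _] := @MVT_segment R g dg 0 1 ler01 (fun s _ => gd s).
  by apply: derivable_within_continuous => s _; have [] := gd s.
rewrite subr0 mulr1.
have gE s (z : 'I_n -> R) : (forall i, 0 <= z i) ->
    (forall i, u s i = asinh_sqrt (z i)) ->
    g s = asinh_sqrt (lam * \prod_i (1 + z i)^-1).
  move=> z0 uz; rewrite /g /= /L expRD lnK ?posrE // -sumrN expR_sum.
  congr (asinh_sqrt (_ * _)); apply: eq_bigr => i _.
  by rewrite uz ch_asinh_sqrt // expRN lnK // posrE ltr_pwDl.
rewrite (gE 1 x) // => [|i]; last by rewrite /u mul1r addrC subrK.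
rewrite (gE 0 y) // => [->|i]; last by rewrite /u mul0r addr0.
rewrite /dg mulrN normrN.
have := weighted_sum_le (u c) d => /= h.
have S0 : 0 <= D^-1 * \sum_i `|d i| `^ q.
  rewrite mulr_ge0 ?invr_ge0 ?(ltW (lt_trans _ D1)) //.
  by apply: sumr_ge0 => *; exact: powR_ge0.
have := @ge0_ler_powR R q (ltW q0) _ _ _ _ h.
rewrite !nnegrE normr_ge0 powR_ge0 => /(_ isT isT) /le_trans; apply.
by rewrite -powRrM mulVf ?gt_eqF // powRr1.
Qed.

End Recursion.

End Contraction.

(** * The threshold and the branching factor *)

Section LambdaC.
Local Open Scope classical_set_scope.
Local Open Scope ring_scope.

Lemma powR_quot_expR {R : realType} (D : R) : 1 < D ->
  D `^ D / (D - 1) `^ (D + 1) = expR (D * ln D - (D + 1) * ln (D - 1)).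
Proof.
move=> D1; have D0 : 0 < D by exact: lt_trans D1.
by rewrite /powR !gt_eqF ?subr_gt0 // expRB.
Qed.

Lemma lt_lambda_c {R : realType} (c lam : R) : 0 < lam ->
  (lam%:E < lambda_c c)%E ->
  exists D, [/\ 1 < D, c < D & lam <= D `^ D / (D - 1) `^ (D + 1)].
Proof.
move=> lam0; rewrite /lambda_c; have [c1 _|c1] := leP c 1.
  (* At D = 1 + d the numerator is at least 1 and the denominator at most d, so lam * d <= 1
     suffices. *)
  set d := (1 + lam)^-1; have d0 : 0 < d by rewrite invr_gt0 ltr_pwDl ?ltW.
  have d1 : d <= 1 by rewrite invf_le1 ?ltr_pwDl ?(ltW lam0) // lerDl ltW.
  exists (1 + d); have D1 : 1 < 1 + d by rewrite ltrDl.
  split => //; first exact: le_lt_trans D1.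
  rewrite [1 + d - 1]addrC addKr.
  have h1 : 1 <= (1 + d) `^ (1 + d).
    by apply: le_trans (le1r_powR _ _); rewrite ltW.
  have h2 : d `^ (1 + d + 1) <= d.
    by rewrite ge1r_powR ?d0 // lerDr addr_ge0 // ltW.
  rewrite ler_pdivlMr ?powR_gt0 //.
  apply: le_trans h1; apply: le_trans (ler_wpM2l (ltW lam0) h2) _.
  by rewrite ler_pdivrMr ?ltr_pwDl ?(ltW lam0) // mul1r lerDr.
rewrite lte_fin powR_quot_expR // => lamF.
pose F (D : R) := expR (D * ln D - (D + 1) * ln (D - 1)).
(* For c > 1 the strict inequality at c survives slightly to the right of c by continuity. *)
have cF : F x @[x --> c] --> F c.
  have c0 : 0 < c by exact: lt_trans c1.
  apply: (@continuous_comp _ _ _ (fun x : R => x * ln x - (x + 1) * ln (x - 1))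
    expR); last exact: continuous_expR.
  apply: cvgB; apply: cvgM.
  - exact: cvg_id.
  - exact: continuous_ln.
  - by apply: cvgD; [exact: cvg_id|exact: cvg_cst].
  - apply: (@continuous_comp _ _ _ (fun x : R => x - 1) (@ln R)).
      by apply: cvgB; [exact: cvg_id|exact: cvg_cst].
    by apply: continuous_ln; rewrite subr_gt0.
have cF' := cvg_at_right_filter cF.
near c^'+ => D.
have cD : c < D by near: D; exact: nbhs_right_gt.
have D1 : 1 < D by exact: lt_trans cD.
exists D; split => //; rewrite powR_quot_expR // ltW //.
by near: D; exact: (cvgr_gt _ cF').
Unshelve. all: by end_near. Qed.

(** Some b' < D has cutset sums with infimum 0, and replacing b' by the larger D only decreases each
    term. *)
Lemma cutset_sum_lt {R : realType} (nch : seq nat -> nat) (b D eta : R) :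
  br R nch = b%:E -> b < D -> 0 < eta ->
  exists C, is_cutset nch C /\ \sum_(v <- C) D ^- size v < eta.
Proof.
move=> brE bD eta0.
have : (br R nch < D%:E)%E by rewrite brE lte_fin.
move=> /ereal_inf_lt[_ [b' [b'0 infE] <-]]; rewrite lte_fin => b'D.
have : (ereal_inf [set (\sum_(v <- C) b' ^- size v)%:E | C in is_cutset nch]
   < eta%:E)%E by rewrite infE lte_fin.
move=> /ereal_inf_lt[_ [C Ccut <-]]; rewrite lte_fin => Ceta.
exists C; split => //; apply: le_lt_trans Ceta; apply: ler_sum => v _.
have D0 := lt_trans b'0 b'D.
by rewrite lef_pV2 ?posrE ?exprn_gt0 // lerXn2r ?nnegrE ?ltW.
Qed.

End LambdaC.

(** * Words and cutsets *)

Section Words.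
Local Open Scope nat_scope.
Implicit Types (v w x y : seq nat) (nch : seq nat -> nat).

Lemma prefix_rconsP v x : reflect (x = v \/ exists i, prefix (rcons v i) x)
  (prefix v x).
Proof.
apply: (iffP idP) => [/prefixP[[|i s] ->]|[->|[i]]].
- by left; rewrite cats0.
- by right; exists i; rewrite -cat_rcons prefix_prefix.
- exact: prefix_refl.
- by apply: prefix_trans; exact: prefix_rcons.
Qed.

Lemma prefix_rconsN v i : prefix (rcons v i) v = false.
Proof. by apply/negP => /size_prefix; rewrite size_rcons ltnn. Qed.

Lemma prefix_rcons_inj v i j x :
  prefix (rcons v i) x -> prefix (rcons v j) x -> i = j.
Proof.
move=> /prefixP[s ->] /prefixP[t] /(congr1 (fun z => nth 0 z (size v))).
by rewrite !cat_rcons !nth_cat ltnn subnn.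
Qed.

Lemma vertex_prefix nch v x : prefix v x -> vertex nch x -> vertex nch v.
Proof.
move=> /prefixP[s ->] vx k kv; have := vx k.
rewrite size_cat (leq_trans kv (leq_addr _ _)) => /(_ isT).
by rewrite nth_cat kv takel_cat // ltnW.
Qed.

Lemma vertex_rcons nch v i :
  vertex nch (rcons v i) <-> vertex nch v /\ i < nch v.
Proof.
split=> [vi|[vv iv] k].
  split; first exact: vertex_prefix (prefix_rcons v i) vi.
  have := vi (size v); rewrite size_rcons ltnSn => /(_ isT).
  by rewrite nth_rcons ltnn eqxx -cats1 takel_cat // take_size.
rewrite size_rcons ltnS leq_eqVlt => /predU1P[->|kv].
  by rewrite nth_rcons ltnn eqxx -cats1 takel_cat // take_size.
by rewrite nth_rcons kv -cats1 takel_cat ?vv // ltnW.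
Qed.

Lemma is_childP v x : reflect (exists i, x = rcons v i) (is_child v x).
Proof.
apply: (iffP andP) => [[/eqP sx /prefixP[s xE]]|[i ->]]; last first.
  by rewrite size_rcons eqxx prefix_rcons.
move: sx; rewrite xE size_cat -addn1 => /addnI; case: s xE => [|i []] // xE _.
by exists i; rewrite cats1.
Qed.

End Words.

(** * Finiteness of the part above a cutset *)

Section Konig.
Local Open Scope classical_set_scope.
Local Open Scope nat_scope.
Variables (nch : seq nat -> nat) (C : {fset seq nat}).
Hypothesis cutC : is_cutset nch C.

Let below v := Tlt nch C `&` [set x | prefix v x].

Let below_step v : infinite_set (below v) ->
  exists i, i < nch v /\ infinite_set (below (rcons v i)).
Proof.
move=> infv; apply: contrapT => /forallNP fin; apply: infv.
apply: (@sub_finite_set _ _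
    ([set v] `|` \bigcup_(i in `I_(nch v)) below (rcons v i))).
  move=> x [[vx nC] /prefix_rconsP[->|[i vi]]]; first by left.
  right; exists i => //=.
  by have /vertex_rcons[] := vertex_prefix vi vx.
rewrite finite_setU; split; first exact: finite_set1.
apply: bigcup_finite => [|i /= iv]; first exact: finite_II.
by apply: contrapT => infi; apply: (fin i).
Qed.

(** Koenig's argument: if infinite, T_{<C} contains infinitely many vertices below every vertex of
    some ray, but the ray meets C and nothing below that point is in T_{<C}. Without finiteness
    [fset_set] in [Uset] would default to the empty set. *)
Lemma finite_Tlt : finite_set (Tlt nch C).
Proof.
apply: contrapT => infT.
have /choice[next nextP] : forall v, exists i,
    infinite_set (below v) -> i < nch v /\ infinite_set (below (rcons v i)).
  move=> v; have [/below_step[i Hi]|fin] := pselect (infinite_set (below v)).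
    by exists i.
  by exists 0.
pose vs := fix vs k := if k is k'.+1 then rcons (vs k') (next (vs k')) else [::].
have infvs k : infinite_set (below (vs k)).
  elim: k => [|k /nextP[]//].
  by apply: sub_infinite_set infT => x Tx; split => //=; rewrite prefix0s.
pose r k := next (vs k).
have rE k : mkseq r k = vs k by elim: k => //= k IH; rewrite mkseqS IH.
have [|u [uC uE]] := cutC.2.1 r.
  by move=> k; rewrite rE; exact: (nextP _ (infvs k)).1.
have /infinite_setN0[x [[_ /(_ u uC)]]] := infvs (size u).
by rewrite -rE -uE => /negP.
Qed.

Lemma in_Tlt_Uset x : (x \in Uset nch C) <-> Tlt nch C x \/ x \in C.
Proof.
rewrite /Uset in_fsetU in_fset_set; last exact: finite_Tlt.
by split=> [/orP[/set_mem|]|[/mem_set ->|->]]; [left|right| |rewrite orbT].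
Qed.

Lemma Uset_vertex x : x \in Uset nch C -> vertex nch x.
Proof. by move=> /in_Tlt_Uset[[]//|/cutC.1]. Qed.

Lemma Tlt_child v i : Tlt nch C v -> i < nch v ->
  Tlt nch C (rcons v i) \/ rcons v i \in C.
Proof.
move=> [Vv nC] iv; have [viC|viC] := boolP (rcons v i \in C); [by right|left].
split; first exact/vertex_rcons.
move=> u uC; apply: contra (nC u uC) => /prefixP[s].
case/lastP: s => [|s j]; first by rewrite cats0 => E; rewrite E uC in viC.
by rewrite -rcons_cat => /rcons_inj[-> _]; exact: prefix_prefix.
Qed.

Lemma Tlt_notin v : Tlt nch C v -> v \notin C.
Proof. by move=> [_ nC]; apply/negP => /nC; rewrite prefix_refl. Qed.

Lemma Uset_below_cut v x : v \in C -> x \in Uset nch C -> prefix v x -> x = v.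
Proof.
move=> vC /in_Tlt_Uset[[_ /(_ v vC)/negP//]|xC vx].
by rewrite (cutC.2.2 v x).
Qed.

End Konig.

(** * Partition functions *)

Section FsetPowerset.
Local Open Scope fset_scope.
Context {K : choiceType}.
Implicit Types A B : {fset K}.

(** The pair of subsets is recovered from its union by intersecting with A and with B. *)
Lemma fpowersetU_perm A B : [disjoint A & B] ->
  perm_eq (fpowerset (A `|` B))
    [seq X `|` Y | X <- fpowerset A, Y <- fpowerset B].
Proof.
move=> /fdisjointP AB.
have recov (I J : {fset K}) : I `<=` A -> J `<=` B ->
    (I = (I `|` J) `&` A) * (J = (I `|` J) `&` B).
  move=> /fsubsetP IA /fsubsetP JB; split; apply/fsetP => x; rewrite !inE.
    have [xI|xI] := boolP (x \in I) => /=; first by rewrite IA.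
    by apply/esym/negbTE/negP => /andP[/JB xB /AB]; rewrite xB.
  have [xJ|xJ] := boolP (x \in J); first by rewrite orbT JB.
  by rewrite orbF; apply/esym/negbTE/negP => /andP[/IA /AB /negP].
apply: uniq_perm => [||I]; first exact: fset_uniq.
  apply: allpairs_uniq => [||p1 p2]; rewrite ?fset_uniq //.
  move=> /allpairsP[[I1 J1] /= [+ + ->]].
  move=> + + /allpairsP[[I2 J2] /= [+ + ->]].
  rewrite !fpowersetE => a b c d /= E.
  have [eI eJ] := recov _ _ a b; have [eI' eJ'] := recov _ _ c d.
  by congr pair; [rewrite eI E -eI'|rewrite eJ E -eJ'].
rewrite fpowersetE; apply/idP/allpairsP => [IAB|[[I1 J1] /= []]].
  exists (I `&` A, I `&` B); rewrite /= !fpowersetE !fsubsetIr; split => //.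
  by rewrite -fsetIUr; apply/esym/fsetIidPl.
by rewrite !fpowersetE => a b ->; apply: fsetUSS.
Qed.

End FsetPowerset.

Section Partition.
Local Open Scope fset_scope.
Local Open Scope ring_scope.
Context {R : realType} (lam : R).
Hypothesis lam0 : 0 < lam.
Implicit Types (A B I J : {fset seq nat}) (a : seq nat -> bool -> bool).
Implicit Types (v x : seq nat).

(* [a x s] tells whether state [s] is allowed at vertex [x]. *)
Definition Zallow A a : R :=
  \sum_(I <- fpowerset A | indepb I && all (fun x => a x (x \in I)) A)
     lam ^+ #|` I|.

Definition pin v (o : bool) a x s := a x s && ((x == v) ==> (s == o)).
(** The effect of an occupied [v] on the vertices below it, expressed as a constraint on single
    vertices. *)
Definition excl_children v a x s := a x s && ~~ (s && is_child v x).

Lemma eq_Zallow A a a' : (forall x s, x \in A -> a x s = a' x s) ->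
  Zallow A a = Zallow A a'.
Proof.
move=> aa; apply: eq_bigl => I; congr (_ && _).
by apply: eq_in_all => x xA; rewrite aa.
Qed.

Lemma Zallow_ge0 A a : 0 <= Zallow A a.
Proof. by apply: sumr_ge0 => I _; rewrite exprn_ge0 // ltW. Qed.

Lemma indepbP I :
  reflect (forall x y, x \in I -> y \in I -> ~~ is_child x y) (indepb I).
Proof.
apply: (iffP allP) => [h x y xI yI|h x xI].
  by have /allP := h x xI; apply.
by apply/allP => y; exact: h.
Qed.

Lemma Zallow_fset0 a : Zallow fset0 a = 1.
Proof.
rewrite /Zallow fpowerset0 big_mkcond big_seq_fset1 cardfs0 expr0.
by rewrite [indepb _ && _](_ : _ = true).
Qed.

(** With no edge between A and B, both independence and the constraints split, and the weight is
    multiplicative. *)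
Lemma ZallowU A B a : [disjoint A & B] ->
  (forall x y, x \in A -> y \in B -> ~~ is_child x y && ~~ is_child y x) ->
  Zallow (A `|` B) a = Zallow A a * Zallow B a.
Proof.
move=> AB noedge; rewrite /Zallow big_mkcond (perm_big _ (fpowersetU_perm AB)).
rewrite big_allpairs_dep [in RHS]big_mkcond [X in _ * X]big_mkcond /=.
rewrite big_distrlr /= big_seq [in RHS]big_seq; apply: eq_bigr => I.
rewrite fpowersetE => IA; rewrite big_seq [in RHS]big_seq; apply: eq_bigr => J.
rewrite fpowersetE => JB.
have IJ0 : I `&` J = fset0.
  apply/fsetP => x; rewrite !inE; apply/negbTE/negP => /andP[xI xJ].
  have /fdisjointP/(_ x (fsubsetP IA x xI)) := AB.
  by rewrite (fsubsetP JB).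
have indU : indepb (I `|` J) = indepb I && indepb J.
  apply/indepbP/andP => [h|[/indepbP hI /indepbP hJ] x y].
    by split; apply/indepbP => x y xI yI; apply: h; rewrite inE ?xI ?yI ?orbT.
  rewrite !inE => /orP[xI|xJ] /orP[yI|yJ]; [exact: hI| | |exact: hJ].
    by have /andP[] := noedge _ _ (fsubsetP IA _ xI) (fsubsetP JB _ yJ).
  by have /andP[] := noedge _ _ (fsubsetP IA _ yI) (fsubsetP JB _ xJ).
have allU : all (fun x => a x (x \in I `|` J)) (A `|` B) =
    all (fun x => a x (x \in I)) A && all (fun x => a x (x \in J)) B.
  have inA x : x \in A -> (x \in I `|` J) = (x \in I).
    move=> xA; rewrite inE; case: (boolP (x \in J));
      rewrite ?orbF // => /(fsubsetP JB) xB.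
    by have /fdisjointP/(_ x xA) := AB; rewrite xB.
  have inB x : x \in B -> (x \in I `|` J) = (x \in J).
    move=> xB; rewrite inE; case: (boolP (x \in I)) => //= /(fsubsetP IA) xA.
    by have /fdisjointP/(_ x xA) := AB; rewrite xB.
  apply/allP/andP => [h|[/allP hA /allP hB] x].
    split; apply/allP => x xX.
      by rewrite -inA // h // inE xX.
    by rewrite -inB // h // inE xX orbT.
  by rewrite inE => /orP[xA|xB]; [rewrite inA // hA|rewrite inB // hB].
have -> : #|` I `|` J| = (#|` I| + #|` J|)%N by rewrite cardfsU IJ0 cardfs0 subn0.
rewrite indU allU exprD andbACA.
by case: (indepb I && _); case: (indepb J && _); rewrite /= ?mulr0 ?mul0r.
Qed.

Lemma is_child_irr v : is_child v v = false.
Proof. by rewrite /is_child eqn_leq ltnn andbF. Qed.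

(** Split according to the state of [v]. Its parent is not in A, so an occupied [v] restricts only
    its children. *)
Lemma Zallow1 A a v : v \notin A -> (forall x, x \in A -> ~~ is_child x v) ->
  Zallow (v |` A) a =
    (a v true)%:R * lam * Zallow A (excl_children v a)
      + (a v false)%:R * Zallow A a.
Proof.
move=> vA noch.
have dis : [disjoint [fset v] & A].
  by apply/fdisjointP => x; rewrite !inE => /eqP->.
rewrite /Zallow big_mkcond (perm_big _ (fpowersetU_perm dis)) big_allpairs_dep.
have v0 : [fset v] != fset0 by apply/fset0Pn; exists v; rewrite inE.
rewrite fpowerset1 /= (perm_big [:: [fset v]; fset0]); last first.
  apply: uniq_perm; rewrite ?fset_uniq //=; first by rewrite inE v0.
  by move=> x; rewrite !inE orbC.
rewrite !big_cons big_nil /= addr0 !mulr_sumr; congr (_ + _).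
  rewrite [RHS]big_mkcond big_seq [RHS]big_seq; apply: eq_bigr => I.
  rewrite fpowersetE => IA.
  have vI : v \notin I by apply: contra vA; exact: (fsubsetP IA).
  rewrite cardfsU1 vI add1n exprS.
  have -> : indepb (v |` I) = indepb I && [forall x : I, ~~ is_child v (val x)].
    apply/indepbP/andP => [h|[/indepbP hI /forallP hv] x y].
      split; first by apply/indepbP => x y xI yI; apply: h; rewrite !inE ?xI ?yI orbT.
      by apply/forallP => x; apply: h; rewrite !inE ?eqxx // (valP x) orbT.
    rewrite !inE => /predU1P[->|xI] /predU1P[->|yI].
    - by rewrite is_child_irr.
    - exact: (hv [` yI]).
    - by rewrite noch // (fsubsetP IA).
    - exact: hI.
  have -> : all (fun x => a x (x \in v |` I)) (v |` A) =
      a v true && all (fun x => a x (x \in I)) A.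
    have inI x : x \in A -> (x \in v |` I) = (x \in I).
      by move=> xA; rewrite !inE; case: eqP vA => // <-; rewrite xA.
    apply/allP/andP => [h|[av /allP hA] x].
      have := h v; rewrite !inE eqxx /= => /(_ isT) ->; split => //.
      by apply/allP => x xA; rewrite -inI // h // !inE xA orbT.
    by rewrite !inE => /predU1P[->|xA]; [rewrite eqxx|rewrite -in_fset1U inI // hA].
  have -> : all (fun x => excl_children v a x (x \in I)) A =
      all (fun x => a x (x \in I)) A && [forall x : I, ~~ is_child v (val x)].
    rewrite /excl_children; apply/allP/andP => [h|[/allP hA /forallP hI] x xA].
      split; first by apply/allP => x /h /andP[].
      apply/forallP => x; have xI := valP x.
      by have := h _ (fsubsetP IA _ xI); rewrite xI => /andP[].
    rewrite hA //=; have [xI|//] := boolP (x \in I).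
    exact: (hI [` xI]).
  set W := FiniteQuant.quant0b _; set Q := all _ A.
  by case: (indepb I); case: W; case: Q; case: (a v true);
    rewrite /= ?mul0r ?mul1r ?mulr0.
rewrite [RHS]big_mkcond big_seq [RHS]big_seq; apply: eq_bigr => I.
rewrite fpowersetE fset0U => IA.
have vI : v \notin I by apply: contra vA; exact: (fsubsetP IA).
have -> : all (fun x => a x (x \in I)) (v |` A) =
    a v false && all (fun x => a x (x \in I)) A.
  apply/allP/andP => [h|[av /allP hA] x].
    split; first by have := h v; rewrite (negbTE vI); apply; rewrite !inE eqxx.
    by apply/allP => x xA; apply: h; rewrite !inE xA orbT.
  by rewrite !inE => /predU1P[->|/hA//]; rewrite (negbTE vI).
set Q := all _ A; by case: (indepb I); case: Q; case: (a v false);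
  rewrite /= ?mul0r ?mul1r ?mulr0.
Qed.

End Partition.

(** * The recursion for the odds above a cutset *)

Section TreeRecursion.
Local Open Scope fset_scope.
Local Open Scope ring_scope.
Context {R : realType} (lam : R) (nch : seq nat -> nat) (C S : {fset seq nat}).
Hypothesis lam0 : 0 < lam.
Hypothesis cutC : is_cutset nch C.
Implicit Types (v x : seq nat) (a : seq nat -> bool -> bool).
Let U := Uset nch C.

Definition branch v := [fset x in U | prefix v x].
(** Stopping after [k] children allows induction on [k] to factor the partition function. *)
Definition forest v k := [fset x in U | [exists i : 'I_k, prefix (rcons v i) x]].
Definition boundary x s := (x \in C) ==> (s == (x \in S)).
Definition Zroot v o := Zallow lam (branch v) (pin v o boundary).
Definition Ztot v := Zallow lam (branch v) boundary.
Definition Rratio v := Zroot v true / Zroot v false.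

Lemma in_branch v x : (x \in branch v) = (x \in U) && prefix v x.
Proof. by rewrite /branch -/U; move: U => V; rewrite !inE. Qed.

Lemma in_forest v k x :
  (x \in forest v k) = (x \in U) && [exists i : 'I_k, prefix (rcons v i) x].
Proof. by rewrite /forest -/U; move: U => V; rewrite !inE. Qed.

Lemma Zallow_forest v k a :
  Zallow lam (forest v k) a = \prod_(i < k) Zallow lam (branch (rcons v i)) a.
Proof.
elim: k => [|k IH].
  rewrite big_ord0 -(Zallow_fset0 lam a); congr (Zallow lam _ a).
  by apply/fsetP => x; rewrite in_forest inE; apply/negP => /andP[_ /existsP[[]]].
rewrite big_ord_recr /= -IH -ZallowU //.
- congr (Zallow lam _ a); apply/fsetP => x; rewrite inE !in_forest in_branch -andb_orr.
  congr (_ && _); apply/existsP/orP => [[i]|[/existsP[i ix]|kx]].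
  + have := ltn_ord i; rewrite ltnS leq_eqVlt => /predU1P[->|ik]; first by right.
    by left; apply/existsP; exists (Ordinal ik).
  + by exists (widen_ord (leqnSn k) i).
  + by exists ord_max.
- apply/fdisjointP => x; rewrite in_forest in_branch => /andP[_ /existsP[i ix]].
  apply/negP => /andP[_ kx]; have := ltn_ord i.
  by rewrite (prefix_rcons_inj ix kx) ltnn.
- move=> x y; rewrite in_forest in_branch => /andP[_ /existsP[i ix]] /andP[_ ky].
  have ik : i <> k :> nat by move=> E; have := ltn_ord i; rewrite E ltnn.
  apply/andP; split; apply/negP => /andP[_].
    by move=> /(prefix_trans ix) iy; apply: ik; exact: prefix_rcons_inj iy ky.
  by move=> /(prefix_trans ky) kx; apply: ik; exact: prefix_rcons_inj ix kx.
Qed.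

Lemma branchE v : v \in U -> branch v = v |` forest v (nch v).
Proof.
move=> vU; apply/fsetP => x; rewrite in_branch in_fset1U in_forest.
apply/andP/orP => [[xU /prefix_rconsP[->|[i ix]]]|[/eqP->|/andP[xU /existsP[i ix]]]].
- by left.
- right; rewrite xU; apply/existsP.
  have /vertex_rcons[_ iv] := vertex_prefix ix (Uset_vertex cutC xU).
  by exists (Ordinal iv).
- by rewrite prefix_refl.
- by split => //; apply/prefix_rconsP; right; exists i.
Qed.

Lemma Zallow_branch v a : v \in U -> Zallow lam (branch v) a =
  (a v true)%:R * lam *
      \prod_(i < nch v) Zallow lam (branch (rcons v i)) (excl_children v a)
  + (a v false)%:R * \prod_(i < nch v) Zallow lam (branch (rcons v i)) a.
Proof.
move=> vU; rewrite branchE // Zallow1 ?Zallow_forest //.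
- by apply/negP; rewrite in_forest => /andP[_ /existsP[i]]; rewrite prefix_rconsN.
- move=> x; rewrite in_forest => /andP[_ /existsP[i ix]].
  by apply/negP => /andP[_ /(prefix_trans ix)]; rewrite prefix_rconsN.
Qed.

(** Inside the branch of [rcons v i] the only child of [v] is the top vertex, so excluding the
    children of [v] amounts to pinning that vertex unoccupied. *)
Lemma Zroot_true v : v \in U ->
  Zroot v true =
    (boundary v true)%:R * lam * \prod_(i < nch v) Zroot (rcons v i) false.
Proof.
move=> vU; rewrite /Zroot Zallow_branch // /pin eqxx /= andbT andbF mul0r addr0.
congr (_ * _); apply: eq_bigr => i _; apply: eq_Zallow => x s.
rewrite in_branch => /andP[_ ix]; rewrite /excl_children.
have -> : (x == v) = false.
  by apply/negP => /eqP E; rewrite E prefix_rconsN in ix.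
rewrite andbT; congr (_ && _).
have -> : is_child v x = (x == rcons v i).
  apply/is_childP/eqP => [[j xj]|->]; last by exists i.
  by rewrite xj in ix *; rewrite (prefix_rcons_inj ix (prefix_refl _)).
by case: s; case: (x == _).
Qed.

Lemma Zroot_false v : v \in U ->
  Zroot v false = (boundary v false)%:R * \prod_(i < nch v) Ztot (rcons v i).
Proof.
move=> vU; rewrite /Zroot Zallow_branch // /pin eqxx /= andbT andbF !mul0r add0r.
congr (_ * _); apply: eq_bigr => i _; apply: eq_Zallow => x s.
rewrite in_branch => /andP[_ ix].
have -> : (x == v) = false.
  by apply/negP => /eqP E; rewrite E prefix_rconsN in ix.
by rewrite andbT.
Qed.

Lemma ZtotE v : v \in U -> Ztot v = Zroot v true + Zroot v false.
Proof.
move=> vU; rewrite Zroot_false // Zroot_true // /Ztot Zallow_branch //.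
congr (_ * _ + _); apply: eq_bigr => i _; apply: eq_Zallow => x s.
rewrite in_branch => /andP[_ ix]; rewrite /excl_children /pin; congr (_ && _).
have -> : is_child v x = (x == rcons v i).
  apply/is_childP/eqP => [[j xj]|->]; last by exists i.
  by rewrite xj in ix *; rewrite (prefix_rcons_inj ix (prefix_refl _)).
by case: s; case: (x == _).
Qed.

Lemma Tlt_U v : Tlt nch C v -> v \in U.
Proof. by move=> vT; apply/(in_Tlt_Uset cutC); left. Qed.

(** Induction from the cutset up to the root. Lengths in the finite set U are bounded by N, so N -
    |v| drops from a vertex to its child. *)
Lemma Tlt_ind (P : seq nat -> Prop) :
  (forall v, Tlt nch C v ->
     (forall i, (i < nch v)%N -> Tlt nch C (rcons v i) -> P (rcons v i)) -> P v) ->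
  forall v, Tlt nch C v -> P v.
Proof.
move=> step; pose N := \max_(x <- U) size x.
have UN x : x \in U -> (size x <= N)%N.
  by move=> xU; rewrite /N (big_rem _ xU) leq_maxl.
suff H k v : (N - size v < k)%N -> Tlt nch C v -> P v.
  by move=> v; apply: (H (N - size v).+1).
elim: k v => // k IH v; rewrite ltnS => Nv vT; apply: step => // i iv viT.
apply: IH => //; apply: leq_trans Nv.
have := UN _ (Tlt_U viT); rewrite size_rcons => viN.
by rewrite ltn_sub2l.
Qed.

Lemma boundary_Tlt v s : Tlt nch C v -> boundary v s.
Proof. by move=> /Tlt_notin; rewrite /boundary => /negbTE->. Qed.

Lemma cut_U v : v \in C -> v \in U.
Proof. by move=> vC; apply/(in_Tlt_Uset cutC); right. Qed.

Lemma branch_cut v i : v \in C -> branch (rcons v i) = fset0.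
Proof.
move=> vC; apply/fsetP => x; rewrite in_branch inE; apply/negP => /andP[xU ix].
have := Uset_below_cut cutC vC xU (prefix_trans (prefix_rcons v i) ix).
by move=> E; rewrite E prefix_rconsN in ix.
Qed.

Lemma Zroot_cut v s : v \in C ->
  Zroot v s = (s == (v \in S))%:R * (if s then lam else 1).
Proof.
move=> vC; have vU := cut_U vC.
case: s; rewrite ?Zroot_true ?Zroot_false // /boundary vC /= big1 ?mulr1 // => i _.
  by rewrite /Zroot branch_cut // Zallow_fset0.
by rewrite /Ztot branch_cut // Zallow_fset0.
Qed.

Lemma Ztot_gt0 v : v \in U -> 0 < Ztot v.
Proof.
have cut x : x \in C -> 0 < Ztot x.
  move=> xC; rewrite ZtotE ?cut_U // !Zroot_cut //.
  by case: (x \in S); rewrite ?mul1r ?mul0r ?addr0 ?add0r.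
move=> /(in_Tlt_Uset cutC)[|]; last exact: cut.
move: v; apply: Tlt_ind => v vT IH; have vU := Tlt_U vT.
rewrite ZtotE // ltr_wpDl ?Zallow_ge0 // Zroot_false // boundary_Tlt // mul1r.
apply: prodr_gt0 => i _.
by have [/IH->|/cut] := Tlt_child vT (ltn_ord i).
Qed.

Lemma Zroot_ge0 v s : 0 <= Zroot v s.
Proof. exact: Zallow_ge0. Qed.

Lemma Zroot_false_gt0 v : Tlt nch C v -> 0 < Zroot v false.
Proof.
move=> vT; rewrite Zroot_false ?Tlt_U // boundary_Tlt // mul1r.
apply: prodr_gt0 => i _; apply: Ztot_gt0.
by have [/Tlt_U|/cut_U] := Tlt_child vT (ltn_ord i).
Qed.

(** The factors are vacancy probabilities because a child may lie in C: at an occupied cut vertex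
    the odds are infinite, while the division in [Rratio] returns 0. *)
Lemma RratioE v : Tlt nch C v ->
  Rratio v = lam * \prod_(i < nch v) (Zroot (rcons v i) false / Ztot (rcons v i)).
Proof.
move=> vT; rewrite /Rratio Zroot_true ?Zroot_false ?Tlt_U // !boundary_Tlt //.
by rewrite !mul1r big_split /= prodfV mulrA.
Qed.

Lemma Rratio_child v : Tlt nch C v ->
  Zroot v false / Ztot v = (1 + Rratio v)^-1.
Proof.
move=> vT; have Z0 := Zroot_false_gt0 vT.
rewrite ZtotE ?Tlt_U // -invf_div mulrDl divff ?lt0r_neq0 //.
by rewrite addrC.
Qed.

Lemma Rratio_rec v : Tlt nch C v ->
  (forall i, (i < nch v)%N -> Tlt nch C (rcons v i)) ->
  Rratio v = lam * \prod_(i < nch v) (1 + Rratio (rcons v i))^-1.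
Proof.
move=> vT chT; rewrite RratioE //; congr (_ * _).
by apply: eq_bigr => i _; rewrite Rratio_child //; exact: chT.
Qed.

Lemma Rratio_ge0 v : 0 <= Rratio v.
Proof. by rewrite divr_ge0 ?Zroot_ge0. Qed.

(** Each factor in [RratioE] is a probability. This is the starting bound next to the cutset. *)
Lemma Rratio_le v : Tlt nch C v -> Rratio v <= lam.
Proof.
move=> vT; rewrite RratioE // ger_pMr // prodr_ile1 // => i _.
have viU : rcons v i \in U.
  by have [/Tlt_U|/cut_U] := Tlt_child vT (ltn_ord i).
rewrite divr_ge0 ?Zroot_ge0 ?(ltW (Ztot_gt0 viU)) //=.
by rewrite ler_pdivrMr ?Ztot_gt0 // mul1r ZtotE // lerDr Zroot_ge0.
Qed.

(** Identifies the partition function in the definition of the discrepancy with that of the root's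
    branch; as S lies in C, the condition on the trace on C can be checked vertex by vertex. *)
Lemma Zhc_root o : S `<=` C -> Tlt nch C [::] ->
  Zhc nch lam C S o = Zroot [::] o.
Proof.
move=> /fsubsetP SC rT; rewrite /Zhc /Zroot /Zallow -/U.
have -> : branch [::] = U.
  by apply/fsetP => x; rewrite in_branch prefix0s andbT.
rewrite big_mkcond [RHS]big_mkcond big_seq [RHS]big_seq; apply: eq_bigr => I.
rewrite fpowersetE => /fsubsetP IU; congr (if _ then _ else _); congr (_ && _).
apply/andP/allP => [[/eqP IC /eqP rI] x xU|h].
  rewrite /pin /boundary; apply/andP; split; apply/implyP.
    by move=> xC; rewrite -IC !inE xC andbT.
  by move=> /eqP->; rewrite rI.
split.
  apply/eqP/fsetP => x; rewrite !inE; apply/andP/idP => [[xI xC]|xS].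
    have /andP[+ _] := h x (cut_U xC).
    by rewrite /boundary xC xI /= => /eqP <-.
  have xC := SC x xS; have /andP[+ _] := h x (cut_U xC).
  by rewrite /boundary xC xS /= => /eqP ->.
by have /andP[_] := h _ (Tlt_U rT); rewrite eqxx.
Qed.

Lemma Rroot_Rratio : S `<=` C -> Tlt nch C [::] ->
  Rroot nch lam C S = Rratio [::].
Proof. by move=> SC rT; rewrite /Rroot !Zhc_root. Qed.

End TreeRecursion.

(** * Decay towards a cutset *)

Section Decay.
Local Open Scope fset_scope.
Local Open Scope ring_scope.
Context {R : realType} (nch : seq nat -> nat) (D lam : R).
Hypotheses (D1 : 1 < D) (lam0 : 0 < lam).
Hypothesis lamD : lam <= D `^ D / (D - 1) `^ (D + 1).
Let q := (1 - (D - 1) * ln (D / (D - 1)) / 2)^-1.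
(** The power bounds the difference of two coordinates next to the cutset; the factor [D] pays for
    stopping one level above it. *)
Let M := D * asinh_sqrt lam `^ q.

Implicit Types (C S : {fset seq nat}) (v w : seq nat).

Definition cut_weight C v : R :=
  \sum_(w <- C | prefix v w) D ^- size w.

Let D0 : 0 < D. Proof. exact: lt_trans D1. Qed.
Let q0 : 0 < q. Proof. exact: expo_gt0. Qed.

(** A word lies below at most one child of [v]. *)
Lemma sum_cut_weight_le C v n :
  \sum_(i < n) cut_weight C (rcons v i) <= cut_weight C v.
Proof.
rewrite /cut_weight; under eq_bigr do rewrite big_mkcond.
rewrite exchange_big [leRHS]big_mkcond /=; apply: ler_sum => w _.
have w0 : 0 <= D ^- size w by rewrite invr_ge0 exprn_ge0 // ltW.
rewrite -big_mkcond /=.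
case: (pickP (fun i : 'I_n => prefix (rcons v i) w)) => [i iw|none]; last first.
  by rewrite big_pred0 //; case: ifP.
rewrite (big_pred1 i) => [|j].
  by rewrite (prefix_trans (prefix_rcons v i) iw).
apply/idP/eqP => [jw|->//]; apply: val_inj => /=.
exact: prefix_rcons_inj jw iw.
Qed.

Section FixedCutset.
Variables (C S S' : {fset seq nat}).
Hypothesis cutC : is_cutset nch C.
Let X := Rratio lam nch C S.
Let X' := Rratio lam nch C S'.

Lemma asinh_sqrt_Rratio_dist v : Tlt nch C v ->
  `|asinh_sqrt (X v) - asinh_sqrt (X' v)| `^ q
    <= M * (D ^+ size v * cut_weight C v).
Proof.
move: v; apply: (Tlt_ind cutC) => v vT IH.
have M0 : 0 <= M by rewrite mulr_ge0 ?powR_ge0 // ltW.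
(* If some child is in C, the a priori bound is used; otherwise all children are in T_{<C} and the
   contraction applies. *)
have [[i iC]|noC] := pselect (exists i : 'I_(nch v), rcons v i \in C).
  have K : `|asinh_sqrt (X v) - asinh_sqrt (X' v)| <= asinh_sqrt lam.
    have a1 := asinh_sqrt_ge0 (Rratio_ge0 nch C S lam0 v).
    have a2 := asinh_sqrt_ge0 (Rratio_ge0 nch C S' lam0 v).
    have b1 := ler_asinh_sqrt (Rratio_ge0 nch C S lam0 v)
      (Rratio_le S lam0 cutC vT).
    have b2 := ler_asinh_sqrt (Rratio_ge0 nch C S' lam0 v)
      (Rratio_le S' lam0 cutC vT).
    by rewrite ler_norml lerBrDr lerBlDr; apply/andP; split; rewrite /X /X'; lra.
  apply: le_trans (_ : asinh_sqrt lam `^ q <= _).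
    by apply: ge0_ler_powR; rewrite ?nnegrE ?(ltW q0) ?asinh_sqrt_ge0 ?(ltW lam0).
  (* The term of the child in C alone gives [cut_weight] at least D^-(|v| + 1). *)
  rewrite /M mulrAC ler_peMl ?powR_ge0 // mulrA -exprS.
  rewrite -ler_pdivrMl ?exprn_gt0 // mulr1 -(size_rcons v i) /cut_weight.
  rewrite (big_rem _ iC) /= prefix_rcons lerDl.
  by apply: sumr_ge0 => w _; rewrite invr_ge0 exprn_ge0 // ltW.
have chT i : (i < nch v)%N -> Tlt nch C (rcons v i).
  move=> iv; have [//|iC] := Tlt_child vT iv.
  by case: noC; exists (Ordinal iv).
rewrite /X /X' !(Rratio_rec _ lam0 cutC vT) //.
apply: le_trans (asinh_sqrt_contraction D1 lam0 lamD _ _) _.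
- by move=> i; exact: Rratio_ge0.
- by move=> i; exact: Rratio_ge0.
rewrite -/q ler_pdivrMl //.
apply: le_trans (_ : \sum_(i < nch v)
    M * (D ^+ (size v).+1 * cut_weight C (rcons v i)) <= _).
  apply: ler_sum => i _; rewrite -(size_rcons v i).
  by apply: IH => //; exact: chT.
rewrite -!mulr_sumr [leRHS]mulrCA ler_wpM2l // mulrA -exprS.
by rewrite ler_wpM2l ?exprn_ge0 ?(ltW D0) // sum_cut_weight_le.
Qed.

End FixedCutset.

(** A coordinate distance of eps / L at the root gives odds within eps. Using [M + 1] for [M] gives
    a constant that is clearly positive and can be divided by. *)
Lemma discrepancy_le C eps : is_cutset nch C -> [::] \notin C -> 0 < eps ->
  (M + 1) * \sum_(w <- C) D ^- size w
    <= (eps / (2 * expR (asinh_sqrt lam) ^+ 2)) `^ q ->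
  `|discrepancy nch lam C| <= eps.
Proof.
move=> cutC rC eps0; set L := 2 * _ => small.
have L0 : 0 < L by rewrite mulr_gt0 ?exprn_gt0 ?expR_gt0.
have rT : Tlt nch C [::].
  split; first by move=> k.
  by move=> u uC; rewrite prefixs0; apply: contraNneq rC => <-.
have bound S S' : S `<=` C -> S' `<=` C ->
    Rroot nch lam C S - Rroot nch lam C S' <= eps.
  move=> SC SC'; rewrite !Rroot_Rratio //; apply: le_trans (ler_norm _) _.
  have in0l T : 0 <= Rratio lam nch C T [::] <= lam.
    by rewrite Rratio_ge0 // Rratio_le.
  apply: le_trans (dist_le_asinh_sqrt (in0l S) (in0l S')) _.
  rewrite -/L -ler_pdivlMl // mulrC.
  have := asinh_sqrt_Rratio_dist S S' cutC rT.
  rewrite expr0 mul1r /cut_weight => dist.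
  have {dist}le1 : `|asinh_sqrt (Rratio lam nch C S [::]) -
      asinh_sqrt (Rratio lam nch C S' [::])| `^ q <= (eps / L) `^ q.
    apply: le_trans dist _; apply: le_trans small.
    rewrite (eq_bigl xpredT) => [|w]; last by rewrite prefix0s.
    rewrite ler_wpM2r ?lerDl // sumr_ge0 // => w _.
    by rewrite invr_ge0 exprn_ge0 // ltW.
  rewrite leNgt; apply: contraTN le1 => lt1; rewrite -ltNge.
  by rewrite gt0_ltr_powR ?nnegrE ?divr_ge0 // ltW.
rewrite ger0_norm; last exact: bigmax_ge_id.
rewrite /discrepancy big_seq; apply: bigmax_le => [|S]; first exact: ltW.
rewrite fpowersetE => SC; rewrite big_seq; apply: bigmax_le => [|S']; first exact: ltW.
by rewrite fpowersetE => SC'; exact: bound.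
Qed.

Lemma gibbs_unique_of_br (b : R) :
  br R nch = b%:E -> b < D -> gibbs_unique nch lam.
Proof.
move=> brE bD.
set L := 2 * expR (asinh_sqrt lam) ^+ 2.
have L0 : 0 < L by rewrite mulr_gt0 ?exprn_gt0 ?expR_gt0.
have M0 : 0 < M + 1 by rewrite ltr_wpDl // mulr_ge0 ?powR_ge0 // ltW.
(* The first bound puts every vertex of the cutset at depth greater than i, since each term is below
   the sum; the second makes the discrepancy at most 1 / (i + 1). *)
pose eta (i : nat) := Num.min (D ^- i) ((i.+1%:R^-1 / L) `^ q / (M + 1)).
have eta0 i : 0 < eta i.
  rewrite lt_min invr_gt0 exprn_gt0 //= divr_gt0 ?powR_gt0 ?divr_gt0 //.
have /choice[B BP] := fun i => cutset_sum_lt brE bD (eta0 i).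
have far i v : v \in B i -> (i < size v)%N.
  move=> vB; have [_] := BP i; rewrite lt_min => /andP[+ _].
  rewrite (big_rem _ vB) /= => h.
  have {h} : D ^- size v < D ^- i.
    apply: le_lt_trans h; rewrite lerDl sumr_ge0 // => w _.
    by rewrite invr_ge0 exprn_ge0 // ltW.
  by rewrite ltf_pV2 ?posrE ?exprn_gt0 // ltr_eXn2l.
exists B; split; first by move=> i; exact: (BP i).1.
split; first by move=> N; exists N => i Ni v /far /ltnW; exact: leq_trans.
move=> eps eps0; exists (Num.truncn eps^-1) => i Ni.
have [cutB] := BP i; rewrite lt_min => /andP[_ small].
have : `|discrepancy nch lam (B i)| <= i.+1%:R^-1.
  apply: discrepancy_le; rewrite ?invr_gt0 //; first by apply/negP => /far.
  by rewrite mulrC -ler_pdivlMr // ltW.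
move=> /le_lt_trans; apply; rewrite invf_plt ?posrE ?ltr0Sn //.
by apply: lt_le_trans (truncnS_gt _) _; rewrite ler_nat.
Qed.

End Decay.

Theorem theorem5p7 (R : realType) (nch : seq nat -> nat) (b lam : R) :
  infinite_tree nch ->
  br R nch = b%:E ->
  0 < lam ->
  ((lam%:E < lambda_c (b + 1))%E \/
   (spherically_symmetric nch /\ (lam%:E < lambda_c b)%E)) ->
  gibbs_unique nch lam.
Proof.
move=> _ brE lam0 lamc.
have [D [D1 bD lamD]] : exists D,
    [/\ 1 < D, b < D & lam <= D `^ D / (D - 1) `^ (D + 1)].
  (* The first alternative yields D > b + 1, hence D > b; the second yields D > b directly. *)
  case: lamc => [/(lt_lambda_c lam0)[D [D1 bD lamD]]|[_ /(lt_lambda_c lam0)//]].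
  by exists D; split => //; apply: lt_trans bD; rewrite ltrDl.
exact: gibbs_unique_of_br brE bD.
Qed.
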